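(* Let $m\ge1$, let $\mathbf n=(n_1,n_2,\dots,n_{2m})$ be an integer sequence and let $\lambda=-u^2$ with $u\in\mathbb C\setminus\{0\}$. Then (i) $\displaystyle W(\mathbf n)=(-1)^{m-1}\begin{pmatrix}-s^{\mathbf n}_{2m+1}(u)&\frac1u s^{\mathbf n}_{2m}(u)\\ -u\,s^{\sigma(\mathbf n)}_{2m}(u)&s^{\sigma(\mathbf n)}_{2m-1}(u)\end{pmatrix}$; (ii) $\displaystyle W^*(\mathbf n)=(-1)^{m-1}\begin{pmatrix}s^{\sigma(\mathbf n)}_{2m-1}(u)&\frac1u s^{\sigma(\mathbf n)}_{2m}(u)\\ -u\,s^{\mathbf n}_{2m}(u)&-s^{\mathbf n}_{2m+1}(u)\end{pmatrix}$.
   Context: $X=\begin{pmatrix}1&1\\0&1\end{pmatrix}$, $Y_\lambda=\begin{pmatrix}1&0\\ \lambda&1\end{pmatrix}$. For $\mathbf n=(n_1,\dots,n_{2m})$, $W(\mathbf n)=X^{n_1}Y_\lambda^{n_2}X^{n_3}Y_\lambda^{n_4}\cdots X^{n_{2m-1}}Y_\lambda^{n_{2m}}$ and $W^*(\mathbf n)=Y_\lambda^{n_1}X^{n_2}Y_\lambda^{n_3}X^{n_4}\cdots Y_\lambda^{n_{2m-1}}X^{n_{2m}}$. For an integer sequence $\mathbf n$: $s^{\mathbf n}_0(t)=0$, $s^{\mathbf n}_1(t)=1$, $s^{\mathbf n}_{j+1}(t)=n_j\,t\,s^{\mathbf n}_j(t)-s^{\mathbf n}_{j-1}(t)$; $\sigma(\mathbf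 n)=(n_2,n_3,\dots)$. *)

(* Defs.v *)
From HB Require Import structures.
From mathcomp Require Import all_boot all_order all_algebra.
Set Implicit Arguments. Unset Strict Implicit. Unset Printing Implicit Defensive.
Import GRing.Theory.
Local Open Scope ring_scope.

Definition mx2 (K : Type) (a b c d : K) : 'M[K]_2 :=
  \matrix_(i, j) if i == 0 then (if j == 0 then a else b)
                 else (if j == 0 then c else d).

Definition matX (K : comUnitRingType) : 'M[K]_2 := mx2 1 1 0 1.

Definition matY (K : comUnitRingType) (lambda : K) : 'M[K]_2 :=
  mx2 1 0 lambda 1.

(* Sequences are stored from index 0: the entry n_j of (n_1, n_2, ...) is
   [n`_(j - 1)].  In [word A B n] the product is the ordered ring product of
   2 x 2 matrices, and the exponents are integers. *)
Definition word (K : comUnitRingType) (A B : 'M[K]_2) (m : nat)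
    (n : (2 * m).-tuple int) : 'M[K]_2 :=
  \prod_(i < m) (A ^ n`_(2 * i) * B ^ n`_(2 * i).+1).

Definition W (K : comUnitRingType) (lambda : K) (m : nat)
    (n : (2 * m).-tuple int) : 'M[K]_2 := word (matX K) (matY lambda) n.

Definition Wstar (K : comUnitRingType) (lambda : K) (m : nat)
    (n : (2 * m).-tuple int) : 'M[K]_2 := word (matY lambda) (matX K) n.

(* s_{k+2} = n_{k+1} t s_{k+1} - s_k.  The value [s n j t] only involves
   n_1, ..., n_{j-1}, so for j <= size n + 1 the default value of [nth] is
   never used. *)
Fixpoint s (K : nzRingType) (n : seq int) (j : nat) (t : K) : K :=
  match j with
  | 0 => 0
  | 1 => 1
  | (k.+1 as k1).+1 => (n`_k)%:~R * t * s n k1 t - s n k t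
  end.

Definition sigma (n : seq int) : seq int := behead n.

(* Main.v *)
Require Import Defs.
From HB Require Import structures.
From mathcomp Require Import all_boot all_order all_algebra.
From mathcomp Require Import reals complex.
From mathcomp Require Import ring.
Set Implicit Arguments. Unset Strict Implicit. Unset Printing Implicit Defensive.
Import GRing.Theory.
Local Open Scope ring_scope.

(** Right multiplication by [X ^ a * Y ^ b] is a pair of column operations;
    with [lambda = - u ^+ 2] each of them is, up to sign and a power of [u], one
    step of the recurrence defining [s], so both identities follow by induction
    on [m]. *)

(** Such an [f] is a one-parameter group. It serves [x] placed in the upper or lower corner of a
    unipotent matrix, giving the integer powers of [matX] and [matY] in closed form. *)
Lemma exprz_additive (V : zmodType) (A : unitRingType) (f : V -> A) :
    f 0 = 1 -> (forall x y, f (x + y) = f x * f y) ->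
  forall x (a : int), f x ^ a = f (x *~ a).
Proof.
move=> f0 fD x.
have fX k : f x ^+ k = f (x *+ k).
  by elim: k => [|k IHk]; rewrite ?expr0 ?mulr0n // exprS IHk -fD -mulrS.
case=> k; first by rewrite -exprnP -pmulrn fX.
(* Negative exponents: [f (- y)] is a two-sided inverse of [f y], hence equal to its ring
   inverse. *)
rewrite NegzE -exprnN -nmulrn fX.
have fNK : f (- (x *+ k.+1)) * f (x *+ k.+1) = 1 by rewrite -fD addNr.
have fKN : f (x *+ k.+1) * f (- (x *+ k.+1)) = 1 by rewrite -fD addrN.
have fU : f (x *+ k.+1) \is a GRing.unit by apply/unitrP; exists (f (- (x *+ k.+1))).
by apply: (mulrI fU); rewrite divrr.
Qed.

Section Words.
Variable K : comUnitRingType.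
Implicit Types (a b c d x y lambda u : K) (n : seq int).

Lemma mx2_mul a b c d a' b' c' d' :
  mx2 a b c d * mx2 a' b' c' d' =
  mx2 (a * a' + b * c') (a * b' + b * d') (c * a' + d * c') (c * b' + d * d').
Proof.
apply/matrixP => i j; rewrite -[LHS]/((mx2 a b c d *m mx2 a' b' c' d') i j) !mxE.
rewrite big_ord_recl big_ord1 !mxE /=.
by case: (i == 0); case: (j == 0).
Qed.

Lemma mx2_scale x a b c d :
  x *: mx2 a b c d = mx2 (x * a) (x * b) (x * c) (x * d).
Proof. by apply/matrixP => i j; rewrite !mxE; do 2!case: ifP. Qed.

Lemma mx2_1 : mx2 1 0 0 1 = 1 :> 'M[K]_2.
Proof.
by apply/matrixP => i j; rewrite !mxE; case: i j => [[|[|i]] ?] [[|[|j]] ?].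
Qed.

Lemma matX_exprz (k : int) : matX K ^ k = mx2 1 k%:~R 0 1.
Proof.
rewrite (exprz_additive (f := fun x => mx2 1 x 0 1)) ?mx2_1 // => x y.
by rewrite mx2_mul; congr mx2; ring.
Qed.

Lemma matY_exprz lambda (k : int) :
  matY lambda ^ k = mx2 1 0 (k%:~R * lambda) 1.
Proof.
rewrite mulrzl (exprz_additive (f := fun x => mx2 1 0 x 1)) ?mx2_1 // => x y.
by rewrite mx2_mul; congr mx2; ring.
Qed.

Local Arguments s : simpl never.

Lemma sSS n k u : s n k.+2 u = (n`_k)%:~R * u * s n k.+1 u - s n k u.
Proof. by []. Qed.

Lemma sigma_nth n k : (sigma n)`_k = n`_k.+1.
Proof. exact: nth_behead. Qed.

(** Here [n] is a plain sequence whose length is independent of [m], so the induction extends the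
    product along one fixed [n]. Taking [m.+1] factors keeps all indices of [s] free of
    subtraction. *)
Lemma prod_word_s n u m : u \is a GRing.unit ->
  \prod_(i < m.+1)
     (matX K ^ n`_(2 * i) * matY (- u ^+ 2) ^ n`_(2 * i).+1) =
  (-1) ^+ m *:
    mx2 (- s n (2 * m).+3 u) (u^-1 * s n (2 * m).+2 u)
        (- u * s (sigma n) (2 * m).+2 u) (s (sigma n) (2 * m).+1 u)
  /\
  \prod_(i < m.+1)
     (matY (- u ^+ 2) ^ n`_(2 * i) * matX K ^ n`_(2 * i).+1) =
  (-1) ^+ m *:
    mx2 (s (sigma n) (2 * m).+1 u) (u^-1 * s (sigma n) (2 * m).+2 u)
        (- u * s n (2 * m).+2 u) (- s n (2 * m).+3 u).
Proof.
move=> uU; have uV : u * u^-1 = 1 by rewrite divrr.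
elim: m => [|m [IHXY IHYX]].
  rewrite !big_ord1 expr0 !scale1r matX_exprz !matY_exprz matX_exprz !mx2_mul /=.
  by rewrite muln0 /s !sigma_nth; split; congr mx2; ring: uV.
rewrite !(big_ord_recr m.+1) IHXY IHYX /= !matX_exprz !matY_exprz.
rewrite !mx2_scale !mx2_mul mulnS !add2n [(-1) ^+ m.+1]exprS.
(* The new factor advances each index by two. Two unfoldings per sequence bring everything back to
   the four values in the induction hypothesis; the shift by [sigma] makes both sequences use the
   same two new exponents. *)
rewrite (sSS n (2 * m).+3) (sSS n (2 * m).+2).
rewrite (sSS (sigma n) (2 * m).+2) (sSS (sigma n) (2 * m).+1) !sigma_nth.
move: (s n (2 * m).+3 u) (s n (2 * m).+2 u) (s (sigma n) (2 * m).+2 u) => p q r.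
move: (s (sigma n) (2 * m).+1 u) n`_(2 * m).+2 n`_(2 * m).+3 => t a b.
move: ((-1) ^+ m) => e.
(* What remains are polynomial identities in independent variables, modulo [u * u^-1 = 1]. *)
by split; congr mx2; ring: uV.
Qed.

Lemma W_Wstar_s m (n : (2 * m).-tuple int) u :
    (1 <= m)%N -> u \is a GRing.unit ->
  W (- u ^+ 2) n =
    (-1) ^+ (m - 1) *:
      mx2 (- s n (2 * m + 1) u)        (u^-1 * s n (2 * m) u)
          (- u * s (sigma n) (2 * m) u) (s (sigma n) (2 * m - 1) u)
  /\
  Wstar (- u ^+ 2) n =
    (-1) ^+ (m - 1) *:
      mx2 (s (sigma n) (2 * m - 1) u)  (u^-1 * s (sigma n) (2 * m) u)
          (- u * s n (2 * m) u)        (- s n (2 * m + 1) u).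
Proof.
case: m n => [//|m] n _ uU; have [prodXY prodYX] := prod_word_s n m uU.
(* The type of [n] contains [2 * m.+1]; abstracting the underlying sequence lets the indices be
   rewritten. *)
rewrite /W /Wstar /word prodXY prodYX; move: (tval n) => l.
by rewrite addn1 !subn1 mulnS !add2n.
Qed.

End Words.

Theorem theorem3p2 (R : realType) (m : nat) (n : (2 * m).-tuple int)
    (u lambda : complex R) :
  (1 <= m)%N -> u != 0 -> lambda = - u ^+ 2 ->
  W lambda n =
    (-1) ^+ (m - 1) *:
      mx2 (- s n (2 * m + 1) u)        (u^-1 * s n (2 * m) u)
          (- u * s (sigma n) (2 * m) u) (s (sigma n) (2 * m - 1) u)
  /\
  Wstar lambda n =
    (-1) ^+ (m - 1) *:
      mx2 (s (sigma n) (2 * m - 1) u)  (u^-1 * s (sigma n) (2 * m) u)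
          (- u * s n (2 * m) u)        (- s n (2 * m + 1) u).
Proof.
by move=> m_gt0 u0 ->; apply: W_Wstar_s; rewrite ?unitfE.
Qed.
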